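(* Let $\Gamma$ be a finite Abelian group and $G$ a graph all of whose vertices are neutral. Suppose $\ell$ is a $\Gamma$-vertex magic labeling of $G$ with magic constant $g$, and $G$ contains an edge $uv$ with $\ell(u)=\ell(v)\neq g$. Let $n\equiv 0\pmod 4$ be a positive integer and let $G^\dagger$ be the graph obtained from $G$ by subdividing the edge $uv$ $n$ times (i.e., replacing $uv$ by a path $u,u_1,\dots,u_n,v$ with $n$ new internal vertices). Then $G^\dagger$ is $\Gamma$-vertex magic.
   Context: Graphs are finite, simple and undirected. For an additive Abelian group $\Gamma$ with identity $0$ and a graph $G$, a $\Gamma$-vertex magic labeling is a map $\ell:V(G)\to\Gamma\setminus\{0\}$ for which there is $\mu\in\Gamma$ (the magic constant) with $w(v)=\sum_{y\in N(v)}\ell(y)=\mu$ for every vertex $v$. A pendant vertex has degree $1$; a support vertex is one adjacent to a pendant vertex; a neutral vertex is neither pendant nor support. *)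

(* Defs.v *)
From mathcomp Require Import all_boot all_order all_algebra.

Set Implicit Arguments.
Unset Strict Implicit.
Unset Printing Implicit Defensive.

Import GRing.Theory.

Record sgraph := SGraph {
  vertex :> finType;
  adj : rel vertex;
  adj_sym : symmetric adj;
  adj_irrefl : irreflexive adj
}.

Section Neighborhoods.
Variable G : sgraph.
Implicit Types v : G.

Definition neighbors v : {set G} := [set y | adj v y].
Definition degree v : nat := #|neighbors v|.
Definition pendant v : bool := degree v == 1.
Definition support_vertex v : bool := [exists y in neighbors v, pendant y].
Definition neutral v : bool := ~~ pendant v && ~~ support_vertex v.

End Neighborhoods.

Section VertexMagic.
Variables (Gamma : zmodType) (G : sgraph).
Local Open Scope ring_scope.

Definition weight (l : G -> Gamma) (v : G) : Gamma :=
  \sum_(y in neighbors v) l y.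

Definition vertex_magic_labeling (l : G -> Gamma) (mu : Gamma) : Prop :=
  (forall v : G, l v <> 0) /\ (forall v : G, weight l v = mu).

Definition vertex_magic : Prop :=
  exists (l : G -> Gamma) (mu : Gamma), vertex_magic_labeling l mu.

End VertexMagic.

(* [inr i : G + 'I_n] is the new vertex u_(i+1) of the path u, u_1, ..., u_n, v
   that replaces the edge uv. The [n == 0] guard keeps uv when there is no new
   vertex. The definition is only meaningful when uv is an edge of G. *)
Section Subdivision.
Variables (G : sgraph) (u v : G) (n : nat).

Definition subdivide_adj (a b : G + 'I_n) : bool :=
  match a, b with
  | inl x, inl y =>
      adj x y && ((n == 0) || ([set x; y] != [set u; v]))
  | inl x, inr i | inr i, inl x =>
      (x == u) && (i == 0 :> nat) || (x == v) && (i.+1 == n)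
  | inr i, inr j => (i.+1 == j) || (j.+1 == i)
  end.

Lemma subdivide_sym : symmetric subdivide_adj.
Proof.
move=> [x|i] [y|j] //=; first by rewrite adj_sym setUC.
by rewrite orbC.
Qed.

Lemma subdivide_irrefl : irreflexive subdivide_adj.
Proof. by case=> [x|i] /=; rewrite ?adj_irrefl // orbb eqn_leq ltnn. Qed.

Definition subdivide : sgraph := SGraph subdivide_sym subdivide_irrefl.

End Subdivision.

(* Main.v *)
Require Import Defs.
From mathcomp Require Import all_boot all_order all_algebra.
From mathcomp Require Import zify.

(** With [a := l u = l v], keep [l] on the old vertices and label the path
    u, u_1, ..., u_n, v by a, a, g-a, g-a, a, a, g-a, g-a, ..., a, a. Labels two
    steps apart add up to [g], so every new vertex has weight [g]. Since 4
    divides n, u_1 and u_n carry [a]: the vertex u loses the neighbor v of label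
    [a] and gains u_1 of label [a], and likewise for v. *)

Import GRing.Theory.

Local Open Scope ring_scope.

Lemma big_orb_disjoint (V : nmodType) (I : finType) (P Q : pred I) (F : I -> V) :
  (forall i, P i -> ~~ Q i) ->
  \sum_(i | P i || Q i) F i = \sum_(i | P i) F i + \sum_(i | Q i) F i.
Proof.
move=> PQ; rewrite (bigID P) /=; congr (_ + _); apply: eq_bigl => i.
  by case: (P i); rewrite ?andbF.
by case Pi: (P i); rewrite ?andbT ?andbF //= (negbTE (PQ _ Pi)).
Qed.

Lemma big_pred1_and (V : nmodType) (I : finType) (i0 : I) (b : bool) (F : I -> V) :
  \sum_(i | (i == i0) && b) F i = if b then F i0 else 0.
Proof.
case: b; first by rewrite (eq_bigl (pred1 i0)) ?big_pred1_eq // => i; rewrite andbT.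
by rewrite big_pred0 // => i; rewrite andbF.
Qed.

(** At the end [u] of the subdivided edge, the only adjacency to an old vertex that is lost is the
    one to [v]. *)
Lemma set2_eq_l (T : finType) (u v y : T) : ([set u; y] == [set u; v]) = (y == v).
Proof.
apply/eqP/eqP => [/setP E|-> //].
move: (E y) (E v); rewrite !inE !eqxx !orbT => /esym/orP[]/eqP-> //.
by rewrite orbb => /eqP->.
Qed.

Section SubdivisionLabeling.
Variables (Gamma : zmodType) (G : sgraph) (l : G -> Gamma) (g : Gamma).
Variables (u v : G) (n : nat).

(** The index [k] is the position on the path: 0 stands for [u], [k] for u_k, and [n.+1] for [v], so
    the two ends obey the same formula as the new vertices. *)
Definition path_label (k : nat) : Gamma :=
  if (k %% 4 < 2)%N then l u else g - l u.

Definition subdivide_label (x : subdivide u v n) : Gamma :=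
  match x with inl y => l y | inr i => path_label i.+1 end.

(** A shift by 2 exchanges the two halves {0, 1} and {2, 3} of the residues mod 4. *)
Lemma path_labelDD k : path_label k + path_label k.+2 = g.
Proof.
rewrite /path_label; have -> : (k.+2 %% 4 < 2)%N = ~~ (k %% 4 < 2)%N by lia.
by case: ifP => _ /=; [rewrite addrC subrK | rewrite subrK].
Qed.

Lemma weight_subdivide x :
  weight subdivide_label x =
    \sum_(y : G | subdivide_adj u v x (inl y)) l y +
    \sum_(i < n | subdivide_adj u v x (inr i)) path_label i.+1.
Proof.
rewrite /weight (eq_bigl (fun y => subdivide_adj u v x y)) ?big_sumType //.
by move=> y; rewrite inE.
Qed.

Hypotheses (uv : adj u v) (luv : l u = l v).
Hypotheses (n_gt0 : (0 < n)%N) (n_mod4 : n = 0 %[mod 4]).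

Lemma adj_neq : u != v.
Proof. by apply/eqP => E; move: uv; rewrite E adj_irrefl. Qed.

Lemma weight_subdivide_old (x : G) :
  weight subdivide_label (inl x) = weight l x.
Proof.
have lab0 : path_label 1 = l u by [].
have labn : path_label n = l u by rewrite /path_label n_mod4.
have wE y : weight l y = \sum_(z | adj y z) l z.
  by apply: eq_bigl => z; rewrite inE.
have weightD y z : adj y z ->
    weight l y = \sum_(t | adj y t && (t != z)) l t + l z.
  by move=> yz; rewrite wE (bigD1 z) // addrC.
have n0 : (n == 0)%N = false by rewrite eqn0Ngt n_gt0.
rewrite weight_subdivide /= n0 /=.
have [->|xu] := eqVneq x u.
  rewrite (weightD _ _ uv) (negbTE adj_neq) /=; congr (_ + _).
    by apply: eq_bigl => y; rewrite set2_eq_l.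
  under eq_bigl do rewrite orbF.
  by rewrite (big_ord1_eq +%R (fun i => path_label i.+1)) n_gt0 lab0.
have [->|xv] := eqVneq x v.
  have vu : adj v u by rewrite adj_sym.
  rewrite (weightD _ _ vu) /=; congr (_ + _).
    by apply: eq_bigl => y; rewrite [[set u; v]]setUC set2_eq_l.
  (* The new neighbor of [v] is u_n, which is [inr] of the ordinal [n.-1]. *)
  rewrite (eq_bigl (fun i : 'I_n => i == n.-1 :> nat)); last by move=> i /=; lia.
  rewrite (big_ord1_eq +%R (fun i => path_label i.+1)).
  by rewrite prednK // leqnn labn.
(* A vertex other than [u] and [v] gains no new neighbor and loses none, since {x, y} = {u, v} would
   force x to be an end. *)
rewrite [X in _ + X]big_pred0 // addr0 wE; apply: eq_bigl => y.
case: eqP => [/setP/(_ x)|]; last by rewrite andbT.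
by rewrite !inE eqxx (negbTE xu) (negbTE xv).
Qed.

(** The vertex [inr i] has position [i.+1]; its neighbors, old or new, have positions [i] and
    [i.+2], so [path_labelDD] gives the weight. *)
Lemma weight_subdivide_new (i : 'I_n) :
  weight subdivide_label (inr i) = g.
Proof.
have lab0 : path_label 0 = l u by [].
have labn : path_label n.+1 = l v.
  by rewrite /path_label -luv; have -> : (n.+1 %% 4 < 2)%N by lia.
rewrite weight_subdivide /= !big_orb_disjoint; first last.
- by move=> y /andP[/eqP-> _]; rewrite (negbTE adj_neq).
- by move=> j /=; lia.
rewrite !big_pred1_and.
under [X in _ + (X + _)]eq_bigl do rewrite eq_sym.
rewrite (big_ord1_eq +%R (fun j => path_label j.+1)).
(* For [i = 0] the left neighbor is [u], already counted among the old vertices. *)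
have -> : \sum_(j < n | (j.+1 == i)%N) path_label j.+1 =
    if (i : nat) is i'.+1 then path_label i'.+1 else 0.
  case: i => -[|i] lt_i /=; first by rewrite big_pred0.
  by rewrite (big_ord1_eq +%R (fun j => path_label j.+1)) ltnW.
rewrite -lab0 -labn -(path_labelDD i).
move: (ltn_ord i); move: (nat_of_ord i) => k; rewrite leq_eqVlt.
(* The right neighbor is [v] if [k.+1 = n], and the new vertex at position [k.+2] otherwise. *)
case/orP=> [/eqP k_last|k_lt].
  by rewrite -k_last ltnn eqxx; case: k {k_last} => [|k]; rewrite ?add0r ?addr0 // addrC.
by rewrite k_lt (ltn_eqF k_lt); case: {k_lt} k => [|k]; rewrite ?add0r ?addr0 // addrC.
Qed.

End SubdivisionLabeling.

Theorem theorem2p14 (Gamma : finZmodType) (G : sgraph)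
    (G_neutral : forall x : G, neutral x)
    (l : G -> Gamma) (g : Gamma)
    (l_magic : vertex_magic_labeling l g)
    (u v : G) (uv : adj u v)
    (luv : l u = l v) (lvg : l v <> g)
    (n : nat) (n_gt0 : (0 < n)%N) (n_mod4 : n = 0 %[mod 4]) :
  vertex_magic Gamma (subdivide u v n).
Proof.
have [l_neq0 l_weight] := l_magic.
exists (@subdivide_label _ _ l g u v n), g; split=> -[x|i].
- exact: l_neq0.
- rewrite /= /path_label; case: ifP => _; first exact: l_neq0.
  (* The label [g - l u] is nonzero because [l u = l v] differs from [g]. *)
  by rewrite luv => /eqP; rewrite subr_eq0 => /eqP/esym.
- by rewrite weight_subdivide_old.
- exact: weight_subdivide_new.
Qed.
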